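(* Let $R$ be a ring, $G$ a finite group acting on $R$, $H$ a subgroup of $G$, and $n\ge 0$ an integer. If the skew group ring $RG$ is a left $n$-coherent ring, then $RH$ is a left $n$-coherent ring. Moreover, if $RG$ is a separable extension over $RH$, then $RG$ is a left $n$-coherent ring if and only if $RH$ is a left $n$-coherent ring.
   Context: Rings are associative with identity; modules are unitary and are left modules unless otherwise specified. $G$ acts on $R$ by ring automorphisms: $r\mapsto g(r)$ is a ring automorphism for each $g\in G$, $(g_1g_2)(r)=g_1(g_2(r))$ and $1(r)=r$. The skew group ring $RG$ is the free left $R$-module with basis $G$ and multiplication $(ag)(bh)=a\,g(b)\,gh$ for $a,b\in R$, $g,h\in G$. For a subgroup $H\le G$ (with the restricted action), $RH$ is a subring of $RG$. A ring $A$ is a separable extension over a subring $S$ if the multiplication map $A\otimes_S A\to A$, $a\otimes b\mapsto ab$, splits as a map of $A$-$A$-bimodules; i.e. there is $\sum_i a_i\otimes b_i\in A\otimes_S A$ with $\sum_i a_i\otimes b_i a=\sum_i a a_i\otimes b_i$ for all $a\in A$ and $\sum_i a_ib_i=1$. An $A$-module $M$ is finitely $n$-presented if there is an exact sequence $F_n\to F_{n-1}\to\cdots\to F_0\to M\to 0$ with all $F_i$ ($0\le i\le n$) finitely generated projective. A ring $A$ is left $n$-coherent if every finitely $n$-presented left $A$-module is finitely $(n+1)$-presented. *)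

(* Defs.v *)
From HB Require Import structures.
From mathcomp Require Import all_boot all_order all_algebra all_fingroup.
From mathcomp Require Import boolp.
From mathcomp Require Import freeg.

Set Implicit Arguments.
Unset Strict Implicit.
Unset Printing Implicit Defensive.

Import GRing.Theory.
Local Open Scope ring_scope.

(* Rings are [pzRingType]s, so that the zero ring is not excluded. *)

(* ract_id and ract_mul make every endomorphism [act g] bijective, with inverse
   [act g^-1]. *)
Record ring_action (gT : finGroupType) (R : pzRingType) := RingAction {
  ract :> gT -> {rmorphism R -> R};
  ract_id : forall r, ract 1%g r = r;
  ract_mul : forall g h r, ract (g * h)%g r = ract g (ract h r)
}.

(* The family [x : skew_ring act] stands for \sum_g (x g) g. It is an alias of
   {ffun gT -> R}, which gives its additive group, but it does not inherit the
   pointwise multiplication. *)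
Definition skew_ring (gT : finGroupType) (R : pzRingType)
  (act : ring_action gT R) : Type := {ffun gT -> R}.

Section SkewRing.

Variables (gT : finGroupType) (R : pzRingType) (act : ring_action gT R).

HB.instance Definition _ := GRing.Zmodule.copy (skew_ring act) {ffun gT -> R}.

Implicit Types (x y z : skew_ring act) (g h k : gT) (a b : R).

Definition skew_monomial a g : skew_ring act :=
  [ffun k => if k == g then a else 0].

Definition skew_one : skew_ring act := skew_monomial 1 1%g.

(* From (a g)(b h) = a g(b) gh: the coefficient of k collects the pairs (g, h)
   with h = g^-1 k. *)
Definition skew_mul x y : skew_ring act :=
  [ffun k => \sum_g x g * act g (y (g^-1 * k)%g)].

Fact skew_mulA : associative skew_mul.
Proof.
move=> x y z; apply/ffunP => k; rewrite !ffunE.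
under eq_bigr => g _ do rewrite ffunE rmorph_sum mulr_sumr.
under [RHS]eq_bigr => g _ do rewrite ffunE mulr_suml.
rewrite [RHS]exchange_big /=; apply: eq_bigr => g _.
rewrite [RHS](reindex_inj (mulgI g)) /=; apply: eq_bigr => h _.
by rewrite rmorphM /= -ract_mul mulrA mulKg invMg mulgA.
Qed.

Fact skew_mul1 : left_id skew_one skew_mul.
Proof.
move=> x; apply/ffunP => k; rewrite ffunE (bigD1 1%g) //= big1 => [|g ng1].
  by rewrite ffunE eqxx mul1r invg1 mul1g ract_id addr0.
by rewrite ffunE (negPf ng1) mul0r.
Qed.

Fact skew_mulr1 : right_id skew_one skew_mul.
Proof.
move=> x; apply/ffunP => k; rewrite ffunE (bigD1 k) //= big1 => [|g ngk].
  by rewrite ffunE mulVg eqxx rmorph1 mulr1 addr0.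
by rewrite ffunE -eq_invg_mul invgK (negPf ngk) rmorph0 mulr0.
Qed.

Fact skew_mulDl : left_distributive skew_mul +%R.
Proof.
move=> x y z; apply/ffunP => k; rewrite !ffunE -big_split.
by apply: eq_bigr => g _; rewrite ffunE mulrDl.
Qed.

Fact skew_mulDr : right_distributive skew_mul +%R.
Proof.
move=> x y z; apply/ffunP => k; rewrite !ffunE -big_split.
by apply: eq_bigr => g _; rewrite ffunE rmorphD mulrDr.
Qed.

HB.instance Definition _ := GRing.Zmodule_isPzRing.Build (skew_ring act)
  skew_mulA skew_mul1 skew_mulr1 skew_mulDl skew_mulDr.

Lemma skew_monomialM a g b h :
  skew_monomial a g * skew_monomial b h = skew_monomial (a * act g b) (g * h)%g.
Proof.
apply/ffunP => k; rewrite !ffunE (bigD1 g) //= big1 => [|g' ng'].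
  rewrite !ffunE eqxx addr0 -(inj_eq (mulgI g)) mulKVg.
  by case: ifP; rewrite // rmorph0 mulr0.
by rewrite ffunE (negPf ng') mul0r.
Qed.

Lemma skew_monomial_sum x : x = \sum_g skew_monomial (x g) g.
Proof.
apply/ffunP => k; rewrite sum_ffunE (bigD1 k) //= big1 => [|g ngk].
  by rewrite ffunE eqxx addr0.
by rewrite ffunE eq_sym (negPf ngk).
Qed.

Definition supported (H : {group gT}) : {pred skew_ring act} :=
  fun x => [forall g, (x g != 0) ==> (g \in H)].

Lemma supportedP (H : {group gT}) x :
  reflect (forall g, g \notin H -> x g = 0) (x \in supported H).
Proof.
apply: (iffP forallP) => [Hx g|Hx g].
  by apply: contraNeq => xg; move: (Hx g); rewrite xg.
by apply/implyP; apply: contraNT => /Hx ->.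
Qed.

Fact supported_subring H : subring_closed (supported H).
Proof.
split.
- apply/supportedP => g; rewrite ffunE; apply: contraNeq.
  by case: (eqVneq g) => [-> _|_]; rewrite ?group1 ?eqxx.
- move=> x y /supportedP xH /supportedP yH; apply/supportedP => g gH.
  by rewrite !ffunE xH ?yH ?subr0.
- move=> x y /supportedP xH /supportedP yH; apply/supportedP => k kH.
  rewrite ffunE big1 // => g _; have [gH|gH] := boolP (g \in H).
    by rewrite yH ?rmorph0 ?mulr0 // groupMl ?groupV.
  by rewrite xH ?mul0r.
Qed.

HB.instance Definition _ H :=
  GRing.isSubringClosed.Build (skew_ring act) (supported H) (supported_subring H).

(* The skew group ring RH of the subgroup H, as the subring of RG consisting of
   the elements \sum_(h in H) a_h h. *)
Record skew_subring (H : {group gT}) :=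
  SkewSubring { skew_subring_val :> skew_ring act; _ : skew_subring_val \in supported H }.

HB.instance Definition _ H := [isSub for @skew_subring_val H].
HB.instance Definition _ H := [Choice of skew_subring H by <:].
HB.instance Definition _ H :=
  GRing.SubChoice_isSubPzRing.Build _ _ (skew_subring H) (supported_subring H).

End SkewRing.

Arguments supported {gT R} act H.
Arguments skew_monomial {gT R} act a g.
Arguments skew_subring {gT R} act H.

(* A (x)_S A is the quotient of the free abelian group on A * A by the subgroup
   generated by the biadditivity and S-balancing relators. *)
Section TensorSquare.

Variables (A : pzRingType) (S : subringClosed A).

Local Notation free_pairs := {freeg (A * A)%type / int}.

Inductive tensor_relation : free_pairs -> Prop :=
| TensorRel0 : tensor_relation 0
| TensorRelB u v : tensor_relation u -> tensor_relation v -> tensor_relation (u - v)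
| TensorRelDl a a' b :
    tensor_relation (<< (a + a', b) >> - (<< (a, b) >> + << (a', b) >>))
| TensorRelDr a b b' :
    tensor_relation (<< (a, b + b') >> - (<< (a, b) >> + << (a, b') >>))
| TensorRelS a s b : s \in S ->
    tensor_relation (<< (a * s, b) >> - << (a, s * b) >>).

Definition tensor_relators : {pred free_pairs} := fun u => `[< tensor_relation u >].

Fact tensor_relators_zmod : zmod_closed tensor_relators.
Proof.
split=> [|u v /asboolP ru /asboolP rv]; apply/asboolP; first exact: TensorRel0.
exact: TensorRelB.
Qed.

HB.instance Definition _ :=
  GRing.isZmodClosed.Build free_pairs tensor_relators tensor_relators_zmod.

Definition tensor_square : Type := Quotient.quot tensor_relators.
HB.instance Definition _ := GRing.Zmodule.on tensor_square.

Definition tens (a b : A) : tensor_square :=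
  \pi_(Quotient.quot tensor_relators)%qT << (a, b) >>.

Lemma tensDl a a' b : tens (a + a') b = tens a b + tens a' b.
Proof.
apply: etrans (Quotient.pi_add _ _ _); apply/eqP; rewrite -Quotient.idealrBE.
exact/asboolP/TensorRelDl.
Qed.

Lemma tensDr a b b' : tens a (b + b') = tens a b + tens a b'.
Proof.
apply: etrans (Quotient.pi_add _ _ _); apply/eqP; rewrite -Quotient.idealrBE.
exact/asboolP/TensorRelDr.
Qed.

Lemma tensS a s b : s \in S -> tens (a * s) b = tens a (s * b).
Proof.
move=> sS; apply/eqP; rewrite -Quotient.idealrBE.
exact/asboolP/TensorRelS.
Qed.

(* The sequence s lists the pairs (a_i, b_i) of a separability element
   \sum_i a_i (x) b_i. *)
Definition separable_extension : Prop :=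
  exists s : seq (A * A),
    (forall a, \sum_(p <- s) tens p.1 (p.2 * a) = \sum_(p <- s) tens (a * p.1) p.2)
    /\ \sum_(p <- s) p.1 * p.2 = 1.

End TensorSquare.

Section Coherence.

Variable A : pzRingType.

Definition finitely_generated (M : lmodType A) : Prop :=
  exists (m : nat) (v : 'I_m -> M),
    forall x, exists a : 'I_m -> A, x = \sum_i a i *: v i.

Definition surjective (T U : Type) (f : T -> U) : Prop := forall y, exists x, f x = y.

Definition projective (P : lmodType A) : Prop :=
  forall (M N : lmodType A) (f : {linear M -> N}) (g : {linear P -> N}),
    surjective f -> exists h : {linear P -> M}, forall x, f (h x) = g x.

Definition exact_at (M N P : lmodType A) (f : M -> N) (g : N -> P) : Prop :=
  forall y, g y = 0 <-> exists x, f x = y.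

(* F_n -> ... -> F_0 -> M -> 0 with d i : F_(i+1) -> F_i and eps : F_0 -> M.
   The sequence is indexed by nat, but only F_i for i <= n and d i for i < n are
   constrained. *)
Definition finitely_presented (n : nat) (M : lmodType A) : Prop :=
  exists (F : nat -> lmodType A) (d : forall i, {linear F i.+1 -> F i})
         (eps : {linear F 0 -> M}),
    [/\ forall i, (i <= n)%N -> finitely_generated (F i) /\ projective (F i),
        surjective eps,
        (0 < n)%N -> exact_at (d 0) eps
      & forall i, (i.+1 < n)%N -> exact_at (d i.+1) (d i)].

Definition left_coherent (n : nat) : Prop :=
  forall M : lmodType A, finitely_presented n M -> finitely_presented n.+1 M.

End Coherence.

(* Main.v *)
(* Write S = RH and A = RG, let pi : A -> S be the restriction of supports to H,
   and let T be a transversal of the right cosets of H. Then pi is an S-bimodule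
   map with pi 1 = 1, and x = \sum_t pi (x t^-1) t = \sum_t t^-1 pi (t x): the
   extension A of S is Frobenius and split. Consequently both restriction of
   modules from A to S and coinduction Hom_S(A, -) from S to A are exact, preserve
   finitely generated projective modules, and preserve and reflect finite
   generation. By Schanuel-type arguments, such a functor preserves and reflects
   finite n-presentation for every n, and hence reflects n-coherence. *)

Require Import Defs.
From HB Require Import structures.
From mathcomp Require Import all_boot all_order all_algebra all_fingroup.
From mathcomp Require Import boolp.

Set Implicit Arguments.
Unset Strict Implicit.
Unset Printing Implicit Defensive.

Import GRing.Theory.
Local Open Scope ring_scope.

(** * Finitely presented modules *)

Definition mk_linear (A : pzRingType) (M N : lmodType A) (f : M -> N)
    (f_lin : linear f) : {linear M -> N} :=
  HB.pack f (GRing.isLinear.Build A M N *:%R f f_lin).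

(** * Kernels of linear maps as modules *)

Section Kernel.

Variables (A : pzRingType) (M N : lmodType A) (f : {linear M -> N}).

Definition kernel_pred : {pred M} := fun x => f x == 0.

Fact kernel_submod : subsemimod_closed kernel_pred.
Proof.
split; [split|]; first by rewrite unfold_in raddf0.
- by move=> x y /eqP fx /eqP fy; rewrite unfold_in raddfD /= fx fy addr0.
- by move=> a x /eqP fx; rewrite unfold_in linearZ /= fx scaler0.
Qed.

Record kernel := Kernel { kernel_val :> M; _ : kernel_val \in kernel_pred }.

HB.instance Definition _ := [isSub for kernel_val].
HB.instance Definition _ := [Choice of kernel by <:].
HB.instance Definition _ :=
  GRing.SubChoice_isSubLmodule.Build A M kernel_pred kernel kernel_submod.

Fact kernel_incl_linear : linear (fun x : kernel => val x : M).
Proof. by move=> a x y; rewrite linearP. Qed.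

Definition kernel_incl : {linear kernel -> M} := mk_linear kernel_incl_linear.

Lemma kernel_incl_inj : injective kernel_incl.
Proof. exact: val_inj. Qed.

Lemma kernel_exact : exact_at kernel_incl f.
Proof.
move=> y; split=> [/eqP fy|[[x fx] <-]]; first by exists (Kernel fy).
exact/eqP.
Qed.

End Kernel.

(** * Short exact sequences, finite generation and projectivity *)

Section Modules.

Variable A : pzRingType.
Implicit Types K L M N P Q U W X Y Z : lmodType A.

Definition short_exact K P M : Prop :=
  exists (i : {linear K -> P}) (p : {linear P -> M}),
    [/\ injective i, surjective p & exact_at i p].

Lemma short_exact_kernel P M (p : {linear P -> M}) :
  surjective p -> short_exact (kernel p) P M.
Proof.
move=> p_surj; exists (kernel_incl p), p.
by split; [exact: kernel_incl_inj | | exact: kernel_exact].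
Qed.

(** Exactness identifies [K] with the kernel of [p]. Preimages under [i] are picked by choice, and
    injectivity of [i] makes the selection linear. *)
Lemma exact_factor U K P M (i : {linear K -> P}) (p : {linear P -> M})
    (f : {linear U -> P}) :
  injective i -> exact_at i p -> (forall u, p (f u) = 0) ->
  exists g : {linear U -> K}, forall u, i (g u) = f u.
Proof.
move=> i_inj ip pf0; have /choice[g gE] u := (ip _).1 (pf0 u).
have g_lin : linear g.
  by move=> a u v; apply: i_inj; rewrite linearP !gE linearP.
by exists (mk_linear g_lin).
Qed.

Lemma kernel_factor U P M (p : {linear P -> M}) (f : {linear U -> P}) :
  (forall u, p (f u) = 0) ->
  exists g : {linear U -> kernel p}, forall u, kernel_incl p (g u) = f u.
Proof. exact: exact_factor (@kernel_incl_inj _ _ _ p) (@kernel_exact _ _ _ p). Qed.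

Lemma kernel_inclK P M (p : {linear P -> M}) u : p (kernel_incl p u) = 0.
Proof. by apply/kernel_exact; exists u. Qed.

Lemma kernelP P M (p : {linear P -> M}) x : p x = 0 -> exists u, kernel_incl p u = x.
Proof. by move/kernel_exact. Qed.

Lemma comp_surjective (T U V : Type) (f : T -> U) (g : U -> V) :
  surjective f -> surjective g -> surjective (g \o f).
Proof.
by move=> f_surj g_surj z; have [y <-] := g_surj z; have [x <-] := f_surj y; exists x.
Qed.

Lemma surjective_lift (I T U : Type) (p : T -> U) (w : I -> U) :
  surjective p -> exists w' : I -> T, forall j, p (w' j) = w j.
Proof. by move=> p_surj; have [w' w'E] := choice (fun j => p_surj (w j)); exists w'. Qed.

(** Allows generating families indexed by sums and products of finite types. *)
Lemma finitely_generatedP M :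
  finitely_generated M <->
  exists (I : finType) (v : I -> M),
    forall x, exists a : I -> A, x = \sum_i a i *: v i.
Proof.
split=> [[m [v vP]]|[I [v vP]]]; first by exists 'I_m, v.
exists #|I|, (v \o enum_val) => x; have [a ->] := vP x; exists (a \o enum_val).
rewrite (reindex (@enum_val I predT)) //.
by exists enum_rank => i _; [exact: enum_valK | exact: enum_rankK].
Qed.

Lemma finitely_generated_surj M N (f : {linear M -> N}) :
  surjective f -> finitely_generated M -> finitely_generated N.
Proof.
move=> f_surj [m [v vP]]; exists m, (f \o v) => y.
have [x <-] := f_surj y; have [a ->] := vP x; exists a.
by rewrite linear_sum; apply: eq_bigr => i _; rewrite linearZ.
Qed.

(** Images of generators of [X] together with lifts of generators of [Z] generate [Y]. *)
Lemma finitely_generated_ext X Y Z :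
  short_exact X Y Z -> finitely_generated X -> finitely_generated Z ->
  finitely_generated Y.
Proof.
move=> [i [p [_ p_surj ex]]] [m [v vP]] [k [w wP]].
have [w' w'E] := surjective_lift w p_surj.
apply/finitely_generatedP.
exists ('I_m + 'I_k)%type, (fun s => match s with inl j => i (v j) | inr j => w' j end).
move=> y; have [b bE] := wP (p y).
have [|x xE] := (ex (y - \sum_j b j *: w' j)).1.
  rewrite raddfB /= linear_sum bE; apply/eqP; rewrite subr_eq0; apply/eqP.
  by apply: eq_bigr => j _; rewrite linearZ /= w'E.
have [a aE] := vP x.
exists (fun s => match s with inl j => a j | inr j => b j end).
rewrite big_sumType /= -(subrK (\sum_j b j *: w' j) y) -xE aE linear_sum; congr (_ + _).
by apply: eq_bigr => j _; rewrite linearZ.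
Qed.

Definition fg_projective P : Prop := finitely_generated P /\ projective P.

(** One direction of the dual basis lemma: lifts of the [g (v i)] through [f], recombined with the
    linear coordinates [c i], give the lift of [g]. *)
Lemma dual_basis_fg_projective P (I : finType) (c : I -> {linear P -> A^o})
    (v : I -> P) :
  (forall x, x = \sum_i (c i x : A) *: v i) -> fg_projective P.
Proof.
move=> cv; split; first by apply/finitely_generatedP; exists I, v => x; exists (c^~ x).
move=> M N f g f_surj.
have [w wE] := surjective_lift (g \o v) f_surj.
have h_lin : linear (fun x => \sum_i (c i x : A) *: w i).
  move=> a x y; rewrite scaler_sumr -big_split; apply: eq_bigr => i _ /=.
  by rewrite linearP scalerDl scalerA.
exists (mk_linear h_lin) => x; rewrite /= linear_sum {2}(cv x) linear_sum.
by apply: eq_bigr => i _; rewrite !linearZ /= wE.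
Qed.

Lemma free_fg_projective (I : finType) : fg_projective {ffun I -> A^o}.
Proof.
have c_lin (i : I) : linear (fun x : {ffun I -> A^o} => x i).
  by move=> a x y; rewrite !ffunE.
apply: (@dual_basis_fg_projective _ I (fun i => mk_linear (c_lin i))
          (fun i => [ffun j => if j == i then 1 else 0])) => x.
apply/ffunP => j; rewrite sum_ffunE (bigD1 j) //= big1 => [|i ij].
  by rewrite !ffunE eqxx addr0 /GRing.scale /= mulr1.
by rewrite !ffunE eq_sym (negPf ij) scaler0.
Qed.

Lemma free_cover M : finitely_generated M ->
  exists (P : lmodType A) (p : {linear P -> M}), fg_projective P /\ surjective p.
Proof.
move=> [m [v vP]].
have p_lin : linear (fun a : {ffun 'I_m -> A^o} => \sum_i (a i : A) *: v i).
  move=> a x y; rewrite scaler_sumr -big_split; apply: eq_bigr => i _ /=.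
  by rewrite !ffunE scalerDl scalerA.
exists {ffun 'I_m -> A^o}, (mk_linear p_lin); split; first exact: free_fg_projective.
move=> x; have [a ->] := vP x; exists (finfun (a : 'I_m -> A^o)) => /=.
by apply: eq_bigr => i _; rewrite ffunE.
Qed.

Fact snd_linear M N : linear (fun u : M * N => u.2).
Proof. by []. Qed.
Fact inl_linear M N : linear (fun x : M => (x, 0 : N)).
Proof. by move=> a x y; apply/pair_equal_spec; rewrite /= scaler0 addr0. Qed.
Fact inr_linear M N : linear (fun y : N => (0 : M, y)).
Proof. by move=> a x y; apply/pair_equal_spec; rewrite /= scaler0 addr0. Qed.
Fact pair_linear X M N (f : {linear X -> M}) (g : {linear X -> N}) :
  linear (fun x => (f x, g x)).
Proof. by move=> a x y; rewrite !linearP. Qed.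
Fact copair_linear X M N (f : {linear M -> X}) (g : {linear N -> X}) :
  linear (fun u => f u.1 + g u.2).
Proof. by move=> a x y; rewrite /= !linearP scalerDr addrACA. Qed.

Lemma fg_projective_prod P Q :
  fg_projective P -> fg_projective Q -> fg_projective (P * Q)%type.
Proof.
move=> [Pfg Pproj] [Qfg Qproj]; split.
  apply: finitely_generated_ext Pfg Qfg.
  exists (mk_linear (@inl_linear P Q)), (mk_linear (@snd_linear P Q)); split=> /=.
  - by move=> x y [].
  - by move=> y; exists (0, y).
  - move=> [x y]; split=> [/= ->|[z [_ <-]]] //; by exists x.
move=> M N f g f_surj.
have [h hE] := Pproj _ _ f (g \o mk_linear (@inl_linear P Q)) f_surj.
have [k kE] := Qproj _ _ f (g \o mk_linear (@inr_linear P Q)) f_surj.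
exists (mk_linear (copair_linear h k)) => -[x y] /=.
rewrite raddfD /= hE kE /= -raddfD /=; congr (g _).
by apply/pair_equal_spec; rewrite addr0 add0r.
Qed.

(** * Finite n-presentation through successive syzygies *)

(** A form of [finitely_presented] suited to induction on [n]: it exposes one syzygy at a time
    instead of a whole resolution. *)
Fixpoint presented (n : nat) (M : lmodType A) : Prop :=
  match n with
  | 0 => finitely_generated M
  | n'.+1 => exists P K : lmodType A,
      [/\ fg_projective P, short_exact K P M & presented n' K]
  end.

Lemma short_exact_fg_quotient X Y Z :
  short_exact X Y Z -> finitely_generated Y -> finitely_generated Z.
Proof. by move=> [i [p [_ p_surj _]]]; apply: finitely_generated_surj p_surj. Qed.

Lemma presented_fg n M : presented n M -> finitely_generated M.
Proof.
case: n => [//|n [P [K [[Pfg _] KPM _]]]].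
exact: short_exact_fg_quotient KPM Pfg.
Qed.

(** The kernel of the identity serves as the zero module. *)
Lemma short_exact_zero P : short_exact (kernel (idfun : {linear P -> P})) P P.
Proof. by apply: short_exact_kernel => x; exists x. Qed.

Lemma kernel_id0 P (x : kernel (idfun : {linear P -> P})) : x = 0.
Proof. by apply: kernel_incl_inj; rewrite raddf0; case: x => x /= /eqP. Qed.

Lemma zero_fg_projective Z : (forall x : Z, x = 0) -> fg_projective Z.
Proof.
move=> Z0; apply: (@dual_basis_fg_projective _ void (fun i => match i with end)
  (fun i => match i with end)) => x.
by rewrite (Z0 x) [RHS]Z0.
Qed.

Lemma fg_projective_presented n P : fg_projective P -> presented n P.
Proof.
elim: n P => [|n IHn] P Pproj; first by case: Pproj.
exists P, (kernel (idfun : {linear P -> P})); split=> //.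
  exact: short_exact_zero.
by apply/IHn/zero_fg_projective/kernel_id0.
Qed.

(** The horseshoe lemma: with [s] a lift of [r] along [p], the module [P * Q] covers [Y], and the
    kernel of this cover is an extension of [L] by [K]. *)
Lemma presented_ext n X Y Z :
  short_exact X Y Z -> presented n X -> presented n Z -> presented n Y.
Proof.
elim: n X Y Z => [|n IHn] X Y Z; first exact: finitely_generated_ext.
move=> [i [p [i_inj p_surj ip]]].
move=> [P [K [Pproj [k [q [k_inj q_surj kq]]] Kn]]].
move=> [Q [L [Qproj [l [r [l_inj r_surj lr]]] Ln]]].
have [s sE] := Qproj.2 _ _ p r p_surj.
pose t := mk_linear (copair_linear (i \o q) s).
have pi0 x : p (i x) = 0 by apply/ip; exists x.
have t_surj : surjective t.
  move=> y; have [b bE] := r_surj (p y).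
  have [|x xE] := (ip (y - s b)).1; first by rewrite raddfB /= sE bE subrr.
  have [a aE] := q_surj x; exists (a, b) => /=.
  by rewrite aE xE subrK.
have [a aE] : exists a : {linear K -> kernel t}, forall x, kernel_incl t (a x) = (k x, 0).
  apply: (kernel_factor (f := mk_linear (@inl_linear P Q) \o k)) => x /=.
  by rewrite (kq (k x)).2 ?raddf0 ?addr0 //; exists x.
have [b bE] : exists b : {linear kernel t -> L},
    forall u, l (b u) = (kernel_incl t u).2.
  apply: (exact_factor (p := r) (f := mk_linear (@snd_linear P Q) \o kernel_incl t)) => //= u.
  by have /(congr1 p) := kernel_inclK u; rewrite /= raddfD raddf0 /= pi0 add0r sE.
exists (P * Q)%type, (kernel t); split; first exact: fg_projective_prod.
  exact: short_exact_kernel.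
apply: IHn Kn Ln; exists a, b; split.
- by move=> x y /(congr1 (kernel_incl t)); rewrite !aE => -[/k_inj].
- move=> z; have lz0 : r (l z) = 0 by apply/lr; exists z.
  (* A preimage of [z] has the form [(y, l z)] with [i (q y) = - s (l z)]; such a [y] exists because
     [p] kills [s (l z)]. *)
  have [|x xE] := (ip (- s (l z))).1; first by rewrite raddfN /= sE lz0 oppr0.
  have [y yE] := q_surj x.
  have [|u uE] := @kernelP _ _ t (y, l z); first by rewrite /= yE xE addNr.
  by exists u; apply: l_inj; rewrite bE uE.
- move=> u; split=> [bu0|[x <-]]; last first.
    by apply: l_inj; rewrite bE aE raddf0.
  have u2 : (kernel_incl t u).2 = 0 by rewrite -bE bu0 raddf0.
  have u1 : q (kernel_incl t u).1 = 0.
    apply: i_inj; rewrite raddf0 -[RHS](kernel_inclK u) /= u2.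
    by rewrite raddf0 addr0.
  have [x xE] := (kq _).1 u1; exists x; apply: kernel_incl_inj.
  by rewrite aE xE -u2 -surjective_pairing.
Qed.

(** The composite [P -> Y -> Z] covers [Z], and its kernel is an extension of [X] by [K]. *)
Lemma presented_quotient n X Y Z :
  short_exact X Y Z -> presented n X -> presented n.+1 Y -> presented n.+1 Z.
Proof.
move=> [i [p [i_inj p_surj ip]]] Xn [P [K [Pproj [k [q [k_inj q_surj kq]]] Kn]]].
have t_surj : surjective (p \o q) by apply: comp_surjective.
exists P, (kernel (p \o q)); split=> //; first exact: short_exact_kernel.
have pi0 x : p (i x) = 0 by apply/ip; exists x.
have qk0 x : q (k x) = 0 by apply/kq; exists x.
have [a aE] : exists a : {linear K -> kernel (p \o q)},
    forall x, kernel_incl _ (a x) = k x.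
  by apply: kernel_factor => x /=; rewrite qk0 raddf0.
have [b bE] : exists b : {linear kernel (p \o q) -> X},
    forall u, i (b u) = q (kernel_incl _ u).
  by apply: (exact_factor (f := q \o kernel_incl _) i_inj ip) => u; exact: (kernel_inclK u).
apply: presented_ext Kn Xn; exists a, b; split.
- by move=> x y /(congr1 (kernel_incl _)); rewrite !aE => /k_inj.
- move=> x; have [y yE] := q_surj (i x).
  have [|u uE] := @kernelP _ _ (p \o q) y; first by rewrite /= yE.
  by exists u; apply: i_inj; rewrite bE uE.
- move=> u; split=> [bu0|[x <-]]; last by apply: i_inj; rewrite bE aE qk0 raddf0.
  have [|x xE] := (kq (kernel_incl _ u)).1; first by rewrite -bE bu0 raddf0.
  by exists x; apply: kernel_incl_inj; rewrite aE.
Qed.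

(* Both Q and P cover M: the fibre product W of P and Q over M is an extension
   of Q by L, and it is also an extension of P by K which splits, so that K is
   the quotient of W by P. *)
Lemma presented_syzygy n K Q M :
  short_exact K Q M -> fg_projective Q -> presented n.+1 M -> presented n K.
Proof.
move=> [k [q [k_inj q_surj kq]]] Qproj.
move=> [P [L [Pproj [l [p [l_inj p_surj lp]]] Ln]]].
have qk0 x : q (k x) = 0 by apply/kq; exists x.
have pl0 x : p (l x) = 0 by apply/lp; exists x.
have [s sE] := Pproj.2 _ _ q p q_surj.
pose t := mk_linear (copair_linear p (\- q)).
have tE u : p (kernel_incl t u).1 = q (kernel_incl t u).2.
  by apply/eqP; rewrite -subr_eq0; apply/eqP; exact: (kernel_inclK u).
have Wn : presented n (kernel t).
  apply: presented_ext Ln (fg_projective_presented n Qproj).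
  have [a aE] : exists a : {linear L -> kernel t}, forall x, kernel_incl t (a x) = (l x, 0).
    apply: (kernel_factor (f := mk_linear (@inl_linear P Q) \o l)) => x /=.
    by rewrite pl0 raddf0 oppr0 addr0.
  exists a, (mk_linear (@snd_linear P Q) \o kernel_incl t); split.
  - by move=> x y /(congr1 (kernel_incl _)); rewrite !aE => -[/l_inj].
  - move=> y; have [x xE] := p_surj (q y).
    have [|u uE] := @kernelP _ _ t (x, y); first by rewrite /= xE subrr.
    by exists u; apply: (congr1 snd uE).
  - move=> u; split=> [u2|[x <-]]; last exact: (congr1 snd (aE x)).
    have {}u2 : (kernel_incl t u).2 = 0 by [].
    have [|x xE] := (lp (kernel_incl t u).1).1; first by rewrite tE u2 raddf0.
    exists x; apply: kernel_incl_inj.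
    by rewrite aE xE -u2 -surjective_pairing.
have WK : short_exact P (kernel t) K.
  have [a aE] : exists a : {linear P -> kernel t}, forall x, kernel_incl t (a x) = (x, s x).
    apply: (kernel_factor (f := mk_linear (pair_linear idfun s))) => x /=.
    by rewrite sE subrr.
  (* The map [b] sends a pair [(x, y)] to [y - s x], which [q] kills since [q] composed with [s] is
     [p]. *)
  have [b bE] : exists b : {linear kernel t -> K},
      forall u, k (b u) = - s (kernel_incl t u).1 + (kernel_incl t u).2.
    apply: (exact_factor (f := mk_linear (copair_linear (\- s) idfun) \o kernel_incl t)
      k_inj kq) => u /=.
    by rewrite raddfD raddfN /= sE tE addNr.
  exists a, b; split.
  - by move=> x y /(congr1 (kernel_incl _)); rewrite !aE => -[].
  - move=> x; have [|u uE] := @kernelP _ _ t (0, k x).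
      by rewrite /= qk0 raddf0 subr0.
    by exists u; apply: k_inj; rewrite bE uE /= raddf0 oppr0 add0r.
  - move=> u; split=> [bu0|[x <-]]; last first.
      by apply: k_inj; rewrite bE aE raddf0 addNr.
    exists (kernel_incl t u).1; apply: kernel_incl_inj.
    have /eqP := bE u; rewrite bu0 raddf0 eq_sym addrC subr_eq0 => /eqP u2.
    by rewrite aE -u2 -surjective_pairing.
(* [presented_quotient] only concludes at positive levels; level 0 is finite generation of a
   quotient. *)
case: n {Ln} Wn => [|n] Wn; first exact: short_exact_fg_quotient WK Wn.
exact: presented_quotient WK (fg_projective_presented n Pproj) Wn.
Qed.

(** * Comparison with the definition by resolutions *)

Lemma presented_finitely_presented n M : presented n M -> finitely_presented n M.
Proof.
elim: n M => [|n IHn] M.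
  move=> /free_cover[P [p [Pproj p_surj]]].
  (* At level 0 only [F 0] and [eps] are constrained, so the rest is a filler. *)
  by exists (fun=> P), (fun=> idfun), p; split.
move=> [P [K [Pproj [k [p [k_inj p_surj kp]]] /IHn]]].
move=> [F [d [eps [Fproj eps_surj ex0 ex]]]].
(* The resolution of [K] is shifted up by one degree, with [P] in degree 0, and spliced in through
   [k \o eps]. *)
pose F' i := if i is j.+1 then F j else P.
pose d' i : {linear F' i.+1 -> F' i} :=
  if i is j.+1 return {linear F' i.+1 -> F' i} then d j else k \o eps.
exists F', d', p; split=> //.
- by case.
- move=> _ y; split=> [/kp[x <-]|[x <-]].
    by have [z <-] := eps_surj x; exists z.
  by apply/kp; exists (eps x).
- case=> [|i] //=; last exact: ex.
  rewrite ltnS => /ex0 ex0n y; rewrite -ex0n; split=> [|epsy0]; last by rewrite /= epsy0 raddf0.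
  by rewrite /= -[X in _ = X](raddf0 k) => /k_inj.
Qed.

(** By exactness [d 0] maps [F 1] onto the kernel of [eps], so the resolution without [F 0] presents
    this first syzygy. *)
Lemma finitely_presented_presented n M : finitely_presented n M -> presented n M.
Proof.
elim: n M => [|n IHn] M [F [d [eps [Fproj eps_surj ex0 ex]]]].
  by apply: finitely_generated_surj eps_surj _; case: (Fproj 0).
have {}ex0 := ex0 isT.
have [c cE] : exists c : {linear F 1 -> kernel eps}, forall x, kernel_incl eps (c x) = d 0 x.
  by apply: kernel_factor => x; apply/ex0; exists x.
exists (F 0), (kernel eps); split; [exact: Fproj | exact: short_exact_kernel |].
apply: IHn; exists (fun i => F i.+1), (fun i => d i.+1), c; split.
- by move=> i; apply: (Fproj i.+1).
- move=> u; have [x xE] := (ex0 _).1 (kernel_inclK u).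
  by exists x; apply: kernel_incl_inj; rewrite cE.
- move=> n0 y; rewrite -(ex 0 _ y) // -cE; split=> [->|cy0]; first exact: raddf0.
  by apply: kernel_incl_inj; rewrite cy0 raddf0.
- by move=> i lt_in; apply: (ex i.+1).
Qed.

Lemma left_coherentP n :
  left_coherent A n <-> forall M, presented n M -> presented n.+1 M.
Proof.
split=> Acoh M Mn; first by
  apply/finitely_presented_presented/Acoh/presented_finitely_presented.
by apply/presented_finitely_presented/Acoh/finitely_presented_presented.
Qed.

End Modules.

(** * Exact functors that reflect finite generation *)

Section ExactFunctor.

Variables (A B : pzRingType) (Phi : lmodType A -> lmodType B).
Hypotheses
  (Phi_exact : forall K P M, short_exact K P M -> short_exact (Phi K) (Phi P) (Phi M))
  (Phi_fg : forall M, finitely_generated (Phi M) <-> finitely_generated M)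
  (Phi_projective : forall P, fg_projective P -> projective (Phi P)).

(** A presentation of [M] is carried over term by term. Conversely, [M] is finitely generated
    because [Phi M] is, hence has a finitely generated projective cover with some kernel [K];
    [presented_syzygy] shows that [Phi K] is presented one level lower, where induction applies. *)
Lemma presented_functor n M : presented n (Phi M) <-> presented n M.
Proof.
have Phi_fg_projective P : fg_projective P -> fg_projective (Phi P).
  by move=> Pproj; split; [apply/Phi_fg; case: Pproj | exact: Phi_projective].
elim: n M => [|n IHn] M; first exact: Phi_fg.
split=> [PhiMn|[P [K [Pproj KPM Kn]]]].
  have [P [p [Pproj p_surj]]] := free_cover ((Phi_fg M).1 (presented_fg PhiMn)).
  have KPM := short_exact_kernel p_surj.
  exists P, (kernel p); split=> //; apply/IHn.
  exact: presented_syzygy (Phi_exact KPM) (Phi_fg_projective _ Pproj) PhiMn.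
exists (Phi P), (Phi K); split; [exact: Phi_fg_projective | exact: Phi_exact |].
exact/IHn.
Qed.

(** Coherence of [B] lengthens the presentation of [Phi M], and the longer one is reflected to
    [M]. *)
Lemma left_coherent_functor n : left_coherent B n -> left_coherent A n.
Proof.
move=> /left_coherentP Bcoh; apply/left_coherentP => M Mn.
exact/presented_functor/Bcoh/presented_functor.
Qed.

End ExactFunctor.

(** * Restriction and coinduction *)

(** An alias of [M], so that scaling by [S] does not compete with scaling by [A]. *)
Definition restriction (S A : pzRingType) (iota : {rmorphism S -> A})
  (M : lmodType A) : Type := M.

Section Restriction.

Variables (S A : pzRingType) (iota : {rmorphism S -> A}).

HB.instance Definition _ (M : lmodType A) :=
  GRing.Zmodule.copy (restriction iota M) M.

Section Module.

Variable M : lmodType A.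

Definition restriction_scale (s : S) (x : restriction iota M) : restriction iota M :=
  iota s *: (x : M).

Fact restriction_scaleA a b x :
  restriction_scale a (restriction_scale b x) = restriction_scale (a * b) x.
Proof. by rewrite /restriction_scale scalerA -rmorphM. Qed.
Fact restriction_scale1 : left_id 1 restriction_scale.
Proof. by move=> x; rewrite /restriction_scale rmorph1 scale1r. Qed.
Fact restriction_scaleDr : right_distributive restriction_scale +%R.
Proof. by move=> a x y; exact: scalerDr. Qed.
Fact restriction_scaleDl x : {morph restriction_scale^~ x : a b / a + b}.
Proof. by move=> a b; rewrite /restriction_scale rmorphD scalerDl. Qed.

HB.instance Definition _ := GRing.Zmodule_isLmodule.Build S (restriction iota M)
  restriction_scaleA restriction_scale1 restriction_scaleDr restriction_scaleDl.

Lemma restriction_scaleE (s : S) (x : restriction iota M) :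
  s *: x = iota s *: (x : M) :> M.
Proof. by []. Qed.

End Module.

Fact restriction_map_linear (M N : lmodType A) (f : {linear M -> N}) :
  linear (f : restriction iota M -> restriction iota N).
Proof. by move=> s x y; apply: linearP. Qed.

Lemma restriction_exact (K P M : lmodType A) :
  short_exact K P M ->
  short_exact (restriction iota K) (restriction iota P) (restriction iota M).
Proof.
move=> [i [p ipP]].
by exists (mk_linear (restriction_map_linear i)), (mk_linear (restriction_map_linear p)).
Qed.

(** The group Hom_S(A, M), on which [a] in [A] acts by right multiplication of the argument:
    [(a f) x = f (x a)]. *)
Record coinduction (M : lmodType S) := Coinduction {
  coinduction_val :> restriction iota A^o -> M;
  coinduction_linear : linear coinduction_val
}.

Section Coinduction.

Variable M : lmodType S.
Implicit Types (f g h : coinduction M) (a b x : A).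

Lemma coinduction_eq f g : f =1 g -> f = g.
Proof.
case: f g => [f flin] [g glin] /= /funext fg; case: g / fg glin => glin.
by congr Coinduction; apply: Prop_irrelevance.
Qed.

HB.instance Definition _ := gen_eqMixin (coinduction M).
HB.instance Definition _ := gen_choiceMixin (coinduction M).

Fact coinduction_zero_linear : linear (fun _ : restriction iota A^o => 0 : M).
Proof. by move=> s x y; rewrite scaler0 addr0. Qed.
Fact coinduction_opp_linear f : linear (fun x : restriction iota A^o => - f x).
Proof. by move=> s x y; rewrite coinduction_linear opprD scalerN. Qed.
Fact coinduction_add_linear f g : linear (fun x : restriction iota A^o => f x + g x).
Proof. by move=> s x y; rewrite !coinduction_linear scalerDr addrACA. Qed.
Fact coinduction_scale_linear a f :
  linear (fun x : restriction iota A^o => f ((x : A) * a)).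
Proof.
move=> s x y; rewrite -coinduction_linear; congr (f _).
by rewrite [LHS]mulrDl restriction_scaleE /GRing.scale /= -mulrA.
Qed.

Definition coinduction_zero := Coinduction coinduction_zero_linear.
Definition coinduction_opp f := Coinduction (coinduction_opp_linear f).
Definition coinduction_add f g := Coinduction (coinduction_add_linear f g).
Definition coinduction_scale a f := Coinduction (coinduction_scale_linear a f).

Fact coinduction_addA : associative coinduction_add.
Proof. by move=> f g h; apply: coinduction_eq => x; apply: addrA. Qed.
Fact coinduction_addC : commutative coinduction_add.
Proof. by move=> f g; apply: coinduction_eq => x; apply: addrC. Qed.
Fact coinduction_add0 : left_id coinduction_zero coinduction_add.
Proof. by move=> f; apply: coinduction_eq => x; apply: add0r. Qed.
Fact coinduction_addN : left_inverse coinduction_zero coinduction_opp coinduction_add.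
Proof. by move=> f; apply: coinduction_eq => x; apply: addNr. Qed.

HB.instance Definition _ := GRing.isZmodule.Build (coinduction M)
  coinduction_addA coinduction_addC coinduction_add0 coinduction_addN.

Fact coinduction_scaleA a b f :
  coinduction_scale a (coinduction_scale b f) = coinduction_scale (a * b) f.
Proof. by apply: coinduction_eq => x /=; rewrite mulrA. Qed.
Fact coinduction_scale1 : left_id 1 coinduction_scale.
Proof. by move=> f; apply: coinduction_eq => x /=; rewrite mulr1. Qed.
Fact coinduction_scaleDr : right_distributive coinduction_scale +%R.
Proof. by move=> a f g; apply: coinduction_eq. Qed.
Fact coinduction_scaleDl f : {morph coinduction_scale^~ f : a b / a + b}.
Proof.
move=> a b; apply: coinduction_eq => x /=.
rewrite mulrDr -[(x : A) * a in LHS](scale1r (x * a : restriction iota A^o)).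
by rewrite coinduction_linear scale1r.
Qed.

HB.instance Definition _ := GRing.Zmodule_isLmodule.Build A (coinduction M)
  coinduction_scaleA coinduction_scale1 coinduction_scaleDr coinduction_scaleDl.

End Coinduction.

(** * Functoriality and exactness of coinduction *)

Section CoinductionMap.

Variables (M N : lmodType S) (f : {linear M -> N}).

Fact coinduction_comp_linear (g : coinduction M) :
  linear (fun x : restriction iota A^o => f (g x)).
Proof. by move=> s x y; rewrite coinduction_linear linearP. Qed.

Fact coinduction_map_linear :
  linear (fun g : coinduction M => Coinduction (coinduction_comp_linear g)).
Proof. by move=> a g h; apply: coinduction_eq => x; apply: raddfD. Qed.

Definition coinduction_map : {linear coinduction M -> coinduction N} :=
  mk_linear coinduction_map_linear.

(** This is the lifting property of [A] as a left [S]-module, applied to a linear map from [A] to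
    [N]. *)
Lemma coinduction_map_surjective :
  projective (restriction iota A^o) -> surjective f -> surjective coinduction_map.
Proof.
move=> Aproj f_surj g.
have [h hE] := Aproj _ _ f (mk_linear (@coinduction_linear _ g)) f_surj.
exists (Coinduction (linearP h)); apply: coinduction_eq => x; exact: hE.
Qed.

End CoinductionMap.

Lemma coinduction_exact (K P M : lmodType S) :
  projective (restriction iota A^o) -> short_exact K P M ->
  short_exact (coinduction K) (coinduction P) (coinduction M).
Proof.
move=> Aproj [i [p [i_inj p_surj ip]]].
exists (coinduction_map i), (coinduction_map p); split.
- move=> g h gh; apply: coinduction_eq => x; apply: i_inj.
  exact: (congr1 (fun k : coinduction P => k x) gh).
- exact: coinduction_map_surjective.
- move=> g; split=> [pg0|[h <-]]; last first.
    by apply: coinduction_eq => x; apply/ip; exists (h x).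
  have [|h hE] := exact_factor (f := mk_linear (@coinduction_linear _ g)) i_inj ip.
    by move=> x; exact: (congr1 (fun k : coinduction M => k x) pg0).
  by exists (Coinduction (linearP h)); apply: coinduction_eq => x; exact: hE.
Qed.

(** Evaluation at 1 is the counit of the adjunction; it is [S]-linear since
    [(s g) 1 = g (iota s) = s (g 1)]. *)
Fact coinduction_eval_linear (M : lmodType S) :
  linear (fun g : restriction iota (coinduction M) => (g : coinduction M) 1).
Proof.
move=> s g h; rewrite -[X in X = _]/((g : coinduction M) (1 * iota s) + (h : coinduction M) 1).
congr (_ + _); rewrite mul1r -[iota s]mulr1.
exact: (linearZ_LR (mk_linear (coinduction_linear g)) s 1).
Qed.

(** * Transposition of maps out of a restricted module *)

Section Adjunct.

Variables (P : lmodType A) (N : lmodType S) (g : {linear restriction iota P -> N}).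

Fact adjunct_fun_linear (p : P) :
  linear (fun x : restriction iota A^o => g ((x : A) *: p)).
Proof.
move=> s x y; rewrite -linearP; congr (g _).
by rewrite -[LHS]/((iota s * (x : A) + (y : A)) *: p) scalerDl -scalerA.
Qed.

Fact adjunct_linear : linear (fun p => Coinduction (adjunct_fun_linear p)).
Proof.
move=> a p q; apply: coinduction_eq => x /=.
rewrite scalerDr scalerA; exact: raddfD.
Qed.

End Adjunct.

(* Coinduction is right adjoint to restriction and preserves surjections. *)
Lemma restriction_projective (P : lmodType A) :
  projective (restriction iota A^o) -> projective P -> projective (restriction iota P).
Proof.
move=> Aproj Pproj M N f g f_surj.
(* The transpose of [g] is lifted through [coinduction_map f]; evaluating the lift at 1 transposes
   it back. *)
have [h hE] := Pproj _ _ (coinduction_map f) (mk_linear (adjunct_linear g))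
  (coinduction_map_surjective Aproj f_surj).
have h_lin : linear (h : restriction iota P -> restriction iota (coinduction M)).
  exact: restriction_map_linear.
exists (mk_linear (@coinduction_eval_linear M) \o mk_linear h_lin) => x.
have /(congr1 (fun k : coinduction N => k 1)) := hE x.
by rewrite /= scale1r.
Qed.

End Restriction.

(** * Split Frobenius extensions *)

(* [pi] is the Frobenius homomorphism, with dual bases [u] and [v]; the extension
   is split by [pi] itself, because of [frobenius1]. *)
Record split_frobenius (S A : pzRingType) (iota : {rmorphism S -> A})
    (pi : A -> S) (I : finType) (u v : I -> A) : Prop := SplitFrobenius {
  frobeniusD : {morph pi : x y / x + y};
  frobeniusMl : forall s x, pi (iota s * x) = s * pi x;
  frobeniusMr : forall s x, pi (x * iota s) = pi x * s;
  frobenius1 : pi 1 = 1;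
  frobenius_dualr : forall x, x = \sum_i iota (pi (x * u i)) * v i;
  frobenius_duall : forall x, x = \sum_i u i * iota (pi (v i * x))
}.

Section Frobenius.

Variables (S A : pzRingType) (iota : {rmorphism S -> A}).
Variables (pi : A -> S) (I : finType) (u v : I -> A).
Hypothesis frob : split_frobenius iota pi u v.

Let coind (M : lmodType S) : lmodType A := coinduction iota M.
Let restr (M : lmodType A) : lmodType S := restriction iota M.

(** The maps [x -> pi (x * u i)] and the elements [v i] form a dual basis of [A] as a left
    [S]-module. *)
Lemma frobenius_fg_projective : fg_projective (restriction iota A^o).
Proof.
have c_lin i : linear (fun x : restriction iota A^o => pi ((x : A) * u i) : S^o).
  move=> s x y; rewrite -[RHS]/(s * pi _ + pi _) -(frobeniusMl frob) -(frobeniusD frob).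
  by rewrite mulrA -mulrDl.
apply: (@dual_basis_fg_projective _ _ I (fun i => mk_linear (c_lin i)) v) => x.
exact: (frobenius_dualr frob).
Qed.

(** Generators over [S] also generate over [A]. Conversely, expanding coefficients in the dual bases
    shows that the products [v j *: w i] generate over [S]. *)
Lemma restriction_fg M : finitely_generated (restr M) <-> finitely_generated M.
Proof.
split=> [[m [w wP]]|[m [w wP]]].
  by exists m, w => x; have [a ->] := wP x; exists (iota \o a).
apply/finitely_generatedP; exists ('I_m * I)%type, (fun k => v k.2 *: (w k.1 : M)).
move=> x; have [a ->] := wP x; exists (fun k => pi (a k.1 * u k.2)).
rewrite -(pair_bigA _ (fun i j => pi (a i * u j) *: (v j *: w i : restr M))) /=.
apply: eq_bigr => i _; rewrite {1}(frobenius_dualr frob (a i)) scaler_suml.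
by apply: eq_bigr => j _; rewrite -scalerA.
Qed.

Section Delta.

Variable M : lmodType S.

Fact delta_fun_linear (m : M) : linear (fun x : restriction iota A^o => pi x *: m).
Proof.
move=> s x y; rewrite (frobeniusD frob) scalerDl scalerA; congr (_ *: m + _).
exact: (frobeniusMl frob).
Qed.

(** The unit of the adjunction with coinduction on the left; [pi 1 = 1] makes it a section of
    evaluation at 1. *)
Definition delta (m : M) : coind M := Coinduction (delta_fun_linear m).

Fact delta_linear : linear (delta : M -> restr (coind M)).
Proof.
move=> s m k; apply: coinduction_eq => x.
(* Since [s] acts on the argument from the right, right linearity of [pi] is what is used. *)
rewrite -[RHS]/(pi (x * iota s) *: m + pi x *: k).
by rewrite (frobeniusMr frob) -scalerA -scalerDr.
Qed.

Lemma coinduction_sum (F : I -> coind M) x : (\sum_i F i) x = \sum_i F i x.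
Proof. exact: (big_morph (fun g : coind M => g x)). Qed.

(** Apply [f] to the expansion of [x] in the dual bases: the summand [pi (x * u i) *: f (v i)] is
    the value at [x] of [u i *: delta (f (v i))]. *)
Lemma coinduction_delta (f : coind M) : f = \sum_i u i *: delta (f (v i)).
Proof.
apply: coinduction_eq => x.
rewrite coinduction_sum {1}(frobenius_dualr frob x).
have f_sum (F : I -> restriction iota A^o) : f (\sum_i F i) = \sum_i f (F i).
  exact: (raddf_sum (mk_linear (@coinduction_linear _ _ _ _ f))).
rewrite f_sum; apply: eq_bigr => i _.
exact: (linearZ_LR (mk_linear (@coinduction_linear _ _ _ _ f))).
Qed.

(** Evaluation at 1 maps onto [M], and its source is finitely generated over [S] by
    [restriction_fg]. Conversely the [delta (w j)] generate: in [coinduction_delta] each [f (v i)]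
    is a combination of the [w j]. *)
Lemma coinduction_fg : finitely_generated (coind M) <-> finitely_generated M.
Proof.
split=> [/restriction_fg|[m [w wP]]].
  apply: (@finitely_generated_surj _ _ _ (mk_linear (@coinduction_eval_linear _ _ iota M))).
  by move=> m; exists (delta m); rewrite /= (frobenius1 frob) scale1r.
apply/finitely_generatedP; exists 'I_m, (delta \o w) => f.
have /choice[a aE] i := wP (f (v i)).
exists (fun j => \sum_i u i * iota (a i j)).
rewrite {1}(coinduction_delta f).
under [RHS]eq_bigr => j _ do rewrite scaler_suml.
rewrite exchange_big; apply: eq_bigr => i _ /=.
rewrite aE; have delta_lin := linear_sum (mk_linear delta_linear).
rewrite -[delta _]/(mk_linear delta_linear _) delta_lin scaler_sumr.
apply: eq_bigr => j _; rewrite -scalerA; congr (_ *: _).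
exact: (linearZ_LR (mk_linear delta_linear)).
Qed.

End Delta.

(* The extension of phi along delta: coinduction is also left adjoint to
   restriction. *)
Fact coadjunct_linear (P : lmodType S) (N : lmodType A) (phi : {linear P -> restr N}) :
  linear (fun f : coind P => \sum_i u i *: (phi (f (v i)) : N)).
Proof.
move=> a f g; rewrite scaler_sumr -big_split /=.
(* Values of [f] at [v i * a] are combinations of its values at the [v j]; the second dual basis
   identity then sums the coefficients over [i] to [a * u j]. *)
have vE i : f (v i * a) = \sum_j pi (v i * a * u j) *: f (v j).
  by rewrite {1}(coinduction_delta f) coinduction_sum.
under eq_bigr => i _ do rewrite raddfD scalerDr.
rewrite !big_split; congr (_ + _).
under eq_bigr => i _ do rewrite /= vE linear_sum scaler_sumr.
rewrite exchange_big; apply: eq_bigr => j _ /=.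
under eq_bigr => i _ do rewrite linearZ /= restriction_scaleE scalerA -mulrA.
by rewrite -scaler_suml -(frobenius_duall frob) scalerA.
Qed.

(** A left adjoint of a functor that preserves surjections preserves projectives: [g] composed with
    [delta] is lifted over [S], and the lift is extended to [coind P]. *)
Lemma coinduction_projective (P : lmodType S) : projective P -> projective (coind P).
Proof.
move=> Pproj M N f g f_surj.
have [h hE] := Pproj _ _ (mk_linear (restriction_map_linear (iota := iota) f))
  (mk_linear (restriction_map_linear (iota := iota) g) \o mk_linear (@delta_linear P)) f_surj.
exists (mk_linear (coadjunct_linear h)) => x.
rewrite {2}(coinduction_delta x) !linear_sum; apply: eq_bigr => i _.
by rewrite !linearZ /=; congr (_ *: _); apply: hE.
Qed.

(** Coinduction, from [S]-modules to [A]-modules, moves coherence from [A] to [S]; restriction moves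
    it back. *)
Theorem left_coherent_frobenius n : left_coherent A n <-> left_coherent S n.
Proof.
have [_ Aproj] := frobenius_fg_projective.
split; [apply: (left_coherent_functor (Phi := coind))
       | apply: (left_coherent_functor (Phi := restr))].
- by move=> K P M; apply: coinduction_exact.
- exact: coinduction_fg.
- by move=> P [_ Pproj]; apply: coinduction_projective.
- exact: restriction_exact.
- exact: restriction_fg.
- by move=> P [_ Pproj]; apply: restriction_projective.
Qed.

End Frobenius.

(** * Skew group rings *)

Section SkewGroupRing.

Variables (gT : finGroupType) (R : pzRingType) (act : ring_action gT R).
Variable H : {group gT}.
Implicit Types (x y : skew_ring act) (s : skew_subring act H) (g k t : gT).

Lemma skew_mulE x y k : (x * y) k = \sum_g x g * act g (y (g^-1 * k)%g).
Proof. by rewrite ffunE. Qed.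

Lemma skew_monomial1l g x k : (skew_monomial act 1 g * x) k = act g (x (g^-1 * k)%g).
Proof.
rewrite skew_mulE (bigD1 g) //= big1 => [|h ng]; first by rewrite ffunE eqxx mul1r addr0.
by rewrite ffunE (negPf ng) mul0r.
Qed.

Lemma skew_monomial1r g x k : (x * skew_monomial act 1 g) k = x (k * g^-1)%g.
Proof.
rewrite skew_mulE (bigD1 (k * g^-1)%g) //= big1 => [|h nh]; rewrite ffunE.
  by rewrite invMg invgK mulgKV eqxx rmorph1 mulr1 addr0.
rewrite -(inj_eq (mulgI h)) mulKVg -(inj_eq (mulIg g^-1%g)) mulgK eq_sym (negPf nh).
by rewrite rmorph0 mulr0.
Qed.

(** * Restriction of supports to H as a Frobenius homomorphism *)

Fact skew_restr_supported x :
  [ffun g => if g \in H then x g else 0] \in supported act H.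
Proof. by apply/supportedP => g gH; rewrite ffunE (negPf gH). Qed.

Definition skew_restr x : skew_subring act H := SkewSubring (skew_restr_supported x).

Lemma skew_restrE x k : val (skew_restr x) k = if k \in H then x k else 0.
Proof. by rewrite ffunE. Qed.

Lemma skew_subring_out s k : k \notin H -> val s k = 0.
Proof. by move/supportedP: (valP s); apply. Qed.

Lemma skew_restrD : {morph skew_restr : x y / x + y}.
Proof.
move=> x y; apply/val_inj/ffunP => k; rewrite raddfD [RHS]ffunE !skew_restrE ffunE.
by case: ifP; rewrite // addr0.
Qed.

(** Only [g] in H contribute, and for these [g^-1 * k] lies in H exactly when [k] does. *)
Lemma skew_restrMl s x : skew_restr (val s * x) = s * skew_restr x.
Proof.
apply/val_inj/ffunP => k; rewrite rmorphM skew_restrE !skew_mulE.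
transitivity (\sum_g if k \in H then val s g * act g (x (g^-1 * k)%g) else 0).
  by case: ifP => // _; rewrite big1.
apply: eq_bigr => g _; rewrite skew_restrE; have [gH|gH] := boolP (g \in H).
  by rewrite groupMl ?groupV //; case: ifP; rewrite // rmorph0 mulr0.
by rewrite skew_subring_out // !mul0r; case: ifP.
Qed.

(** Only [g] with [g^-1 * k] in H contribute, and then [g] lies in H exactly when [k] does. *)
Lemma skew_restrMr s x : skew_restr (x * val s) = skew_restr x * s.
Proof.
apply/val_inj/ffunP => k; rewrite rmorphM skew_restrE !skew_mulE.
transitivity (\sum_g if k \in H then x g * act g (val s (g^-1 * k)%g) else 0).
  by case: ifP => // _; rewrite big1.
apply: eq_bigr => g _; rewrite skew_restrE; have [kH|kH] := boolP (k \in H).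
  case: ifP => // gH.
  by rewrite skew_subring_out ?groupMr ?groupV ?gH // rmorph0 mulr0 mul0r.
case: ifP => [gH|_]; last by rewrite mul0r.
by rewrite skew_subring_out ?rmorph0 ?mulr0 // groupMl ?groupV.
Qed.

Lemma skew_restr1 : skew_restr 1 = 1.
Proof.
apply/val_inj/ffunP => k; rewrite rmorph1 skew_restrE.
case: ifP => // kH; rewrite ffunE; case: eqP => // k1.
by rewrite k1 group1 in kH.
Qed.

(* The dual bases are indexed by the whole of gT, with zero entries outside of
   the transversal of the right cosets of H. *)
Definition is_rcoset_repr t := t == repr (H :* t)%g.

Definition skew_base t : skew_ring act :=
  if is_rcoset_repr t then skew_monomial act 1 t else 0.

Definition skew_dual_base t : skew_ring act :=
  if is_rcoset_repr t then skew_monomial act 1 t^-1%g else 0.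

(** A right coset contains exactly one chosen representative, so a single term survives. *)
Lemma sum_rcoset_repr k (a : R) :
  \sum_t (if is_rcoset_repr t && (t \in (H :* k)%g) then a else 0) = a.
Proof.
have rk : repr (H :* k)%g \in (H :* k)%g := mem_repr_rcoset H k.
rewrite (bigD1 (repr (H :* k)%g)) //= big1 => [|t nt].
  by rewrite rk /is_rcoset_repr (rcoset_eqP rk) eqxx addr0.
case: ifP => // /andP[/eqP rt tk].
by move: nt; rewrite rt (rcoset_eqP tk) eqxx.
Qed.

Lemma skew_split_frobenius :
  split_frobenius (val : {rmorphism skew_subring act H -> skew_ring act})
    skew_restr skew_dual_base skew_base.
Proof.
split; [exact: skew_restrD | exact: skew_restrMl | exact: skew_restrMr |
        exact: skew_restr1 | |].
- move=> x; apply/ffunP => k; rewrite sum_ffunE -[LHS](sum_rcoset_repr k).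
  apply: eq_bigr => t _; rewrite /skew_base /skew_dual_base.
  case: (is_rcoset_repr t) => /=; last by rewrite mulr0 ffunE.
  (* The term of [t] contributes [x k] exactly when [k * t^-1] lies in H, that is, when [t] is in
     the coset of [k]. *)
  rewrite skew_monomial1r skew_restrE skew_monomial1r invgK mulgKV.
  by rewrite -groupV invMg invgK mem_rcoset.
(* Now the condition is that [t * k] lies in H, hence the coset of [k^-1]; the actions of [t] and
   [t^-1] on the coefficient cancel. *)
- move=> x; apply/ffunP => k; rewrite sum_ffunE -[LHS](sum_rcoset_repr k^-1%g).
  apply: eq_bigr => t _; rewrite /skew_base /skew_dual_base.
  case: (is_rcoset_repr t) => /=; last by rewrite mul0r ffunE.
  rewrite skew_monomial1l invgK skew_restrE skew_monomial1l mulKg.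
  rewrite mem_rcoset invgK; case: ifP => _; last by rewrite rmorph0.
  by rewrite -ract_mul mulVg ract_id.
Qed.

End SkewGroupRing.

Theorem proposition3p4 (R : pzRingType) (gT : finGroupType)
    (act : ring_action gT R) (H : {group gT}) (n : nat) :
  (left_coherent (skew_ring act) n -> left_coherent (skew_subring act H) n) /\
  (separable_extension (supported act H) ->
     (left_coherent (skew_ring act) n <-> left_coherent (skew_subring act H) n)).
Proof.
have coherentP := left_coherent_frobenius (skew_split_frobenius act H) n.
by split=> [/coherentP|].
Qed.
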